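(* Each variety generated by 3-hypergraph semirings is equal to a variety generated by 3-uniform hypergraph semirings. That is, for every family $\{\mathbb{H}_i\mid i\in I\}$ of 3-hypergraphs there is a family $\{\mathbb{H}'_j\mid j\in J\}$ of 3-uniform 3-hypergraphs such that the variety generated by $\{S_{\mathbb{H}_i}\mid i\in I\}$ equals the variety generated by $\{S_{\mathbb{H}'_j}\mid j\in J\}$.
   Context: A hypergraph $\mathbb{H}=(V,E)$ consists of a finite set $V$ of vertices and a set $E$ of subsets of $V$ (hyperedges). A 3-hypergraph is a hypergraph whose largest hyperedge has exactly 3 elements and which satisfies the following standing assumptions: it is finite; it is linear (any two distinct hyperedges share at most one vertex); every vertex lies in some hyperedge; every hyperedge has at least 2 elements; and every hyperedge with exactly 2 elements is disjoint from all other hyperedges. It is 3-uniform if every hyperedge has exactly 3 elements. A subhyperedge is a nonempty subset of a hyperedge. Two subhyperedges $e_1',e_2'$ are linked if there is a single vertex $w\notin e_1'\cup e_2'$ such that $e_1'\cup\{w\}$ and $e_2'\cup\{w\}$ are both hyperedges. The 3-hypergraph semigroup $SG_{\mathbb{H}}$ is the semigroup given by the presentation with generators $\mathbf{a}_u$ ($u\in V$) and $0$, and relations: $\mathbf{a}_u\mathbf{a}_v=\mathbf{a}_v\mathbf{a}_u$; $0\mathbf{a}_u=\mathbf{a}_u0=00=0$; $\mathbf{a}_u\mathbf{a}_v=0$ if $u=v$ or $\{u,v\}$ is not a subhyperedge; $\mathbf{a}_u\mathbf{a}_v\mathbf{a}_h=0$ if $\{u,v,h\}\notin E$; $\mathbf{a}_{u_i}\mathbf{a}_{u_j}=\mathbf{a}_{u_r}\mathbf{a}_{u_l}$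 if $\{u_i,u_j\}$ and $\{u_r,u_l\}$ are linked; and for every hyperedge $\{u_1,\dots,u_k\}$ (of $k$ elements), $\mathbf{a}_{u_1}\cdots\mathbf{a}_{u_k}=\mathbf{a}$, where $\mathbf{a}$ is one and the same (nonzero) element for all hyperedges. This semigroup with zero is 0-cancellative ($xy=xz\neq0\Rightarrow y=z$ and dually), and therefore becomes a semiring $S_{\mathbb{H}}$, called the 3-hypergraph semiring of $\mathbb{H}$, under the flat addition $x+x=x$ and $x+y=0$ for $x\ne y$. Varieties are varieties of semirings in the signature $\{+,\cdot\}$ (both operations associative, $+$ commutative, $\cdot$ distributing over $+$ on both sides). *)

(* Defs.v *)
From mathcomp Require Import all_boot.
From mathcomp Require Import boolp.

Set Implicit Arguments.
Unset Strict Implicit.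
Unset Printing Implicit Defensive.

Local Open Scope quotient_scope.

(* Semirings in the signature {+, *}: neither a zero nor a unit is part of the
   structure, so these are not MathComp's (unital, with 0) semirings.  Carriers
   are nonempty, as usual in universal algebra. *)
Record semiring := Semiring {
  scar :> Type;
  sadd : scar -> scar -> scar;
  smul : scar -> scar -> scar;
  scar_nonempty : inhabited scar;
  saddA : associative sadd;
  saddC : commutative sadd;
  smulA : associative smul;
  smulDl : left_distributive smul sadd;
  smulDr : right_distributive smul sadd
}.

Definition semiring_hom (A B : semiring) (f : A -> B) : Prop :=
  {morph f : x y / sadd x y} /\ {morph f : x y / smul x y}.

Section Product.
Variables (I : Type) (A : I -> semiring).
Let T := forall i, A i.
Let add (x y : T) : T := fun i => sadd (x i) (y i).
Let mul (x y : T) : T := fun i => smul (x i) (y i).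

Fact sprod_nonempty : inhabited T.
Proof.
by apply: inhabits => i; exact: (sval (cid (let: inhabits a := scar_nonempty (A i) in
  ex_intro (fun _ : A i => True) a Logic.I))).
Qed.

Fact sprod_addA : associative add.
Proof. by move=> x y z; apply: functional_extensionality_dep => i; exact: saddA. Qed.

Fact sprod_addC : commutative add.
Proof. by move=> x y; apply: functional_extensionality_dep => i; exact: saddC. Qed.

Fact sprod_mulA : associative mul.
Proof. by move=> x y z; apply: functional_extensionality_dep => i; exact: smulA. Qed.

Fact sprod_mulDl : left_distributive mul add.
Proof. by move=> x y z; apply: functional_extensionality_dep => i; exact: smulDl. Qed.

Fact sprod_mulDr : right_distributive mul add.
Proof. by move=> x y z; apply: functional_extensionality_dep => i; exact: smulDr. Qed.

Definition semiring_prod : semiring :=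
  Semiring sprod_nonempty sprod_addA sprod_addC sprod_mulA sprod_mulDl sprod_mulDr.
End Product.

(* Subalgebras are given by embeddings, so that a variety is in particular
   closed under isomorphism. *)
Definition is_variety (C : semiring -> Prop) : Prop :=
  [/\ forall (A B : semiring) (f : A -> B), semiring_hom f ->
        (forall y, exists x, f x = y) -> C A -> C B,
      forall (A B : semiring) (f : B -> A), semiring_hom f ->
        injective f -> C A -> C B
    & forall (I : Type) (A : I -> semiring),
        (forall i, C (A i)) -> C (semiring_prod A)].

Definition variety_gen (I : Type) (S : I -> semiring) (A : semiring) : Prop :=
  forall C, is_variety C -> (forall i, C (S i)) -> C A.

Section Flat.
Variables (T : eqType) (z : T) (mul : T -> T -> T).
Hypotheses (mulA : associative mul)
  (mul0z : left_zero z mul) (mulz0 : right_zero z mul)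
  (cancl : forall x y w, mul x y = mul x w -> mul x y != z -> y = w)
  (cancr : forall x y w, mul y x = mul w x -> mul y x != z -> y = w).

Definition flat_add (x y : T) : T := if x == y then x else z.

Fact flat_addA : associative flat_add.
Proof.
move=> x y w; rewrite /flat_add.
have [->|nyw] := eqVneq y w.
  by have [->|nxw] := eqVneq x w; rewrite ?eqxx // ; case: eqP.
have [exy|nxy] := eqVneq x y.
  by rewrite -exy in nyw *; rewrite (negbTE nyw); case: eqP.
by do 2 case: eqP.
Qed.

Fact flat_addC : commutative flat_add.
Proof. by move=> x y; rewrite /flat_add eq_sym; case: eqP. Qed.

Fact flat_mulDl : left_distributive mul flat_add.
Proof.
move=> x y w; rewrite /flat_add; have [->|nxy] := eqVneq x y.
  by rewrite eqxx.
rewrite mul0z; case: eqP => // e.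
have [->//|n0] := eqVneq (mul x w) z.
by rewrite (cancr e n0) eqxx in nxy.
Qed.

Fact flat_mulDr : right_distributive mul flat_add.
Proof.
move=> w x y; rewrite /flat_add; have [->|nxy] := eqVneq x y.
  by rewrite eqxx.
rewrite mulz0; case: eqP => // e.
have [->//|n0] := eqVneq (mul w x) z.
by rewrite (cancl e n0) eqxx in nxy.
Qed.

Definition flat_semiring : semiring :=
  Semiring (inhabits z) flat_addA flat_addC mulA flat_mulDl flat_mulDr.
End Flat.

Record hypergraph := Hypergraph {
  vertex : finType;
  edges : {set {set vertex}}
}.

Record is_3hypergraph (H : hypergraph) : Prop := Is3Hypergraph {
  edge_linear : forall e f : {set vertex H}, e \in edges H -> f \in edges H ->
    e != f -> #|e :&: f| <= 1;
  edge_cover : forall v : vertex H, exists2 e, e \in edges H & v \in e;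
  edge_ge2 : forall e : {set vertex H}, e \in edges H -> 2 <= #|e|;
  edge2_disjoint : forall e f : {set vertex H}, e \in edges H -> f \in edges H ->
    #|e| = 2 -> e != f -> [disjoint e & f];
  edge_le3 : forall e : {set vertex H}, e \in edges H -> #|e| <= 3;
  edge_eq3 : exists2 e : {set vertex H}, e \in edges H & #|e| = 3
}.

Record hypergraph3 := Hypergraph3 {
  hgraph :> hypergraph;
  hgraph3P : is_3hypergraph hgraph
}.

Definition uniform3 (H : hypergraph) : Prop :=
  forall e : {set vertex H}, e \in edges H -> #|e| = 3.

Definition subhyperedge (H : hypergraph) (s : {set vertex H}) : Prop :=
  s <> set0 /\ exists2 e, e \in edges H & s \subset e.

Definition linked (H : hypergraph) (s t : {set vertex H}) : Prop :=
  [/\ subhyperedge s, subhyperedge t &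
      exists w, [/\ w \notin s :|: t, w |: s \in edges H & w |: t \in edges H]].

(* The alphabet of generators of SG_H is [option (vertex H)]: [Some u] is the
   generator a_u and [None] is the generator 0. *)
Notation gen H := (option (vertex H)).

(* The defining relations.  The common value a of the full hyperedge products
   is not a generator: [pres_edge] identifies all these products. *)
Inductive pres (H : hypergraph) : seq (gen H) -> seq (gen H) -> Prop :=
| pres_comm u v : pres [:: Some u; Some v] [:: Some v; Some u]
| pres_0l u : pres [:: None; Some u] [:: None]
| pres_0r u : pres [:: Some u; None] [:: None]
| pres_00 : pres [:: None; None] [:: None]
| pres_pair u v : u = v \/ ~ subhyperedge [set u; v] ->
    pres [:: Some u; Some v] [:: None]
| pres_triple u v h : [set u; v; h] \notin edges H ->
    pres [:: Some u; Some v; Some h] [:: None]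
| pres_linked u v u' v' : linked [set u; v] [set u'; v'] ->
    pres [:: Some u; Some v] [:: Some u'; Some v']
| pres_edge (s t : seq (vertex H)) : uniq s -> uniq t ->
    [set x in s] \in edges H -> [set x in t] \in edges H ->
    pres (map Some s) (map Some t).

Inductive pres_cong (H : hypergraph) : seq (gen H) -> seq (gen H) -> Prop :=
| cong_step p q l r : pres l r -> pres_cong (p ++ l ++ q) (p ++ r ++ q)
| cong_refl l : pres_cong l l
| cong_sym l r : pres_cong l r -> pres_cong r l
| cong_trans l m r : pres_cong l m -> pres_cong m r -> pres_cong l r.

(* The free semigroup on the generators. *)
Definition word (H : hypergraph) := {w : seq (gen H) | w != [::]}.

Fact word_cat_subproof H (x y : word H) : val x ++ val y != [::].
Proof. by case: x => -[]. Qed.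

Definition word_cat H (x y : word H) : word H :=
  exist (fun w => w != [::]) _ (word_cat_subproof x y).
Definition word_gen H (g : gen H) : word H :=
  exist (fun w => w != [::]) [:: g] isT.

Definition word_eqv H (x y : word H) : bool := `[< pres_cong (val x) (val y) >].

Fact word_eqv_refl H : reflexive (@word_eqv H).
Proof. by move=> x; apply/asboolP; exact: cong_refl. Qed.

Fact word_eqv_sym H : symmetric (@word_eqv H).
Proof. by move=> x y; apply/asboolP/asboolP; exact: cong_sym. Qed.

Fact word_eqv_trans H : transitive (@word_eqv H).
Proof.
move=> y x z /asboolP xy /asboolP yz; apply/asboolP; exact: cong_trans xy yz.
Qed.

Canonical word_equiv H :=
  EquivRel (@word_eqv H) (@word_eqv_refl H) (@word_eqv_sym H) (@word_eqv_trans H).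

Definition SG (H : hypergraph) := {eq_quot (word_equiv H)}.

Definition SG_gen H (g : gen H) : SG H := \pi_(SG H) (word_gen g).
Definition SG_zero H : SG H := SG_gen None.
Definition SG_mul H (x y : SG H) : SG H :=
  \pi_(SG H) (word_cat (repr x) (repr y)).

Section CongTheory.
Variable H : hypergraph.
Implicit Types (l r p q s t : seq (gen H)).

Lemma cong_ctx p q l r : pres_cong l r -> pres_cong (p ++ l ++ q) (p ++ r ++ q).
Proof.
elim=> {l r} [p' q' l r plr|l|l r _ IH|l m r _ IH1 _ IH2].
- have := cong_step (p ++ p') (q' ++ q) plr; by rewrite !catA.
- exact: cong_refl.
- exact: cong_sym.
- exact: cong_trans IH1 IH2.
Qed.

Lemma cong_cat l r l' r' :
  pres_cong l r -> pres_cong l' r' -> pres_cong (l ++ l') (r ++ r').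
Proof.
move=> h h'; apply: (@cong_trans _ _ (r ++ l')); first exact: (cong_ctx [::] l' h).
by have := cong_ctx r [::] h'; rewrite !cats0.
Qed.

Lemma cong_pres l r : pres l r -> pres_cong l r.
Proof. by move=> h; have := cong_step [::] [::] h; rewrite /= !cats0. Qed.

Lemma cong_0l s : @pres_cong H (None :: s) [:: None].
Proof.
elim: s => [|[u|] s IH]; first exact: cong_refl.
  apply: cong_trans IH.
  exact: (cong_ctx [::] s (cong_pres (pres_0l u))).
apply: cong_trans IH; exact: (cong_ctx [::] s (cong_pres (pres_00 H))).
Qed.

Lemma cong_0r s : @pres_cong H (s ++ [:: None]) [:: None].
Proof.
elim: s => [|g s IH]; first exact: cong_refl.
apply: (@cong_trans _ _ [:: g; None]).
  by have := cong_ctx [:: g] [::] IH; rewrite !cats0.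
apply: cong_pres; case: g => [u|]; [exact: pres_0r | exact: pres_00].
Qed.

Lemma cong_absorb p q l :
  pres_cong l [:: None] -> pres_cong (p ++ l ++ q) [:: None].
Proof.
move=> h; apply: cong_trans (cong_ctx p q h) _.
rewrite catA; apply: cong_trans (cong_ctx [::] q (cong_0r p)) _; exact: cong_0l.
Qed.

Lemma cong_swap (g g' : gen H) : pres_cong [:: g; g'] [:: g'; g].
Proof.
case: g g' => [u|] [v|]; first exact: cong_pres (pres_comm u v).
- exact: cong_trans (cong_pres (pres_0r u)) (cong_sym (cong_pres (pres_0l u))).
- exact: cong_trans (cong_pres (pres_0l v)) (cong_sym (cong_pres (pres_0r v))).
- exact: cong_refl.
Qed.

Lemma cong_catC s t : pres_cong (s ++ t) (t ++ s).
Proof.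
have h1 g r : pres_cong (g :: r) (r ++ [:: g]).
  elim: r => [|g' r IH]; first exact: cong_refl.
  apply: cong_trans (cong_ctx [::] r (cong_swap g g')) _.
  by have := cong_ctx [:: g'] [::] IH; rewrite !cats0.
elim: s t => [|g s IH] t; first by rewrite cats0; exact: cong_refl.
apply: cong_trans (h1 g (s ++ t)) _; rewrite -catA.
by apply: cong_trans (IH _) _; rewrite -catA /=; exact: cong_refl.
Qed.

End CongTheory.

(* 0-cancellativity of SG_H, via a complete invariant [nf] of the congruence:
   the elements are 0, the a_u, the common value of hyperedge products, and one
   element [Co w] for the products a_u a_v with {u,v,w} a 3-hyperedge. *)
Section ZeroCancellative.
Variable H : hypergraph.
Hypothesis H3 : is_3hypergraph H.
Implicit Types (u v w h : vertex H) (s t p q : seq (gen H)).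

Let tri u v h := uniq [:: u; v; h] && ([set u; v; h] \in edges H).
Let dbl u v := (u != v) && ([set u; v] \in edges H).

Inductive nf := NZero | NTop | NGen of vertex H | NCo of vertex H.

Definition eval s : nf :=
  match s with
  | [:: Some u] => NGen u
  | [:: Some u; Some v] =>
      if dbl u v then NTop
      else if [pick w | tri u v w] is Some w then NCo w else NZero
  | [:: Some u; Some v; Some h] => if tri u v h then NTop else NZero
  | _ => NZero
  end.

Lemma tri_swap12 u v h : tri u v h = tri v u h.
Proof.
rewrite /tri (setUC [set u]); congr (_ && _) => /=; rewrite !inE (eq_sym v u).
by rewrite !andbT !negb_or; case: (u != v); case: (u != h); case: (v != h).
Qed.

Lemma tri_swap23 u v h : tri u v h = tri u h v.
Proof.
rewrite /tri -!setUA (setUC [set v]); congr (_ && _) => /=; rewrite !inE (eq_sym h v).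
by rewrite !andbT !negb_or; case: (u != v); case: (u != h); case: (v != h).
Qed.

Lemma dblC u v : dbl u v = dbl v u.
Proof. by rewrite /dbl eq_sym setUC. Qed.

Lemma tri_uniq u v w w' : tri u v w -> tri u v w' -> w = w'.
Proof.
move=> /andP[/= /and3P[]]; rewrite !inE !negb_or => /andP[uv uw] vw _ E1.
move=> /andP[/= /and3P[]]; rewrite !inE !negb_or => /andP[_ uw'] vw' _ E2.
have [e|n] := eqVneq [set u; v; w] [set u; v; w'].
  have : w \in [set u; v; w'] by rewrite -e !inE eqxx orbT.
  by rewrite !inE (eq_sym w u) (eq_sym w v) (negbTE uw) (negbTE vw) => /eqP.
have := edge_linear H3 E1 E2 n; have : [set u; v] \subset [set u; v; w] :&: [set u; v; w'].
  by apply/subsetP=> x; rewrite !inE => /orP[] ->; rewrite ?orbT.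
by move/subset_leq_card; rewrite cards2 uv => h /(leq_trans h).
Qed.

Lemma dbl_tri u v h : dbl u v -> tri u v h = false.
Proof.
move=> /andP[uv E1]; apply/negP => /andP[/= /and3P[]].
rewrite !inE !negb_or => /andP[_ uh] vh _ E2.
have n : [set u; v] != [set u; v; h].
  apply/eqP => e; have : h \in [set u; v] by rewrite e !inE eqxx orbT.
  by rewrite !inE (eq_sym h u) (eq_sym h v) (negbTE uh) (negbTE vh).
have c2 : #|[set u; v]| = 2 by rewrite cards2 uv.
have /disjointFr := edge2_disjoint H3 E1 E2 c2 n.
by move=> /(_ u); rewrite !inE eqxx => /(_ isT).
Qed.

Lemma dbl_uniq u v v' : dbl u v -> dbl u v' -> v = v'.
Proof.
move=> /andP[uv E1] /andP[uv' E2].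
have [e|n] := eqVneq [set u; v] [set u; v'].
  have : v \in [set u; v'] by rewrite -e !inE eqxx orbT.
  by rewrite !inE (eq_sym v u) (negbTE uv) => /eqP.
have c2 : #|[set u; v]| = 2 by rewrite cards2 uv.
have /disjointFr := edge2_disjoint H3 E1 E2 c2 n.
by move=> /(_ u); rewrite !inE eqxx => /(_ isT).
Qed.

Lemma tri_card u v h : tri u v h -> #|[set u; v; h]| = 3.
Proof.
case/andP=> /= /and3P[]; rewrite !inE !negb_or => /andP[uv uh] vh _ _.
by rewrite setUC cardsU1 cards2 uv !inE (eq_sym h u) (eq_sym h v) (negbTE uh) (negbTE vh).
Qed.

Lemma dbl_tri1 u v v' h : dbl u v -> tri u v' h = false.
Proof.
move=> d; apply/negP => tr; case/andP: (d) => uv E1; case/andP: (tr) => _ E2.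
have c2 : #|[set u; v]| = 2 by rewrite cards2 uv.
have n : [set u; v] != [set u; v'; h].
  by apply/eqP => e; move: c2; rewrite e (tri_card tr).
have /disjointFr := edge2_disjoint H3 E1 E2 c2 n.
by move=> /(_ u); rewrite !inE eqxx => /(_ isT).
Qed.

Lemma tri_irr u v : tri u u v = false.
Proof. by rewrite /tri /= !inE eqxx. Qed.

Lemma dbl_irr u : dbl u u = false.
Proof. by rewrite /dbl eqxx. Qed.

Lemma eval_dbl u v : dbl u v -> eval [:: Some u; Some v] = NTop.
Proof. by move=> /= ->. Qed.

Lemma eval_tri u v w : tri u v w -> eval [:: Some u; Some v] = NCo w.
Proof.
move=> tr /=; rewrite ifN; last by apply: contraL tr => /(@dbl_tri u v w) ->.
by case: pickP => [w' /(tri_uniq tr) -> //|/(_ w)]; rewrite tr.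
Qed.

Variant eval2_spec u v : nf -> Prop :=
| Eval2Dbl of dbl u v : eval2_spec u v NTop
| Eval2Tri w of tri u v w : eval2_spec u v (NCo w)
| Eval2Zero of (u = v \/ ~ subhyperedge [set u; v]) : eval2_spec u v NZero.

Lemma subhyperedge_pair u v : u != v -> subhyperedge [set u; v] ->
  dbl u v \/ exists w, tri u v w.
Proof.
move=> uv [_ [e eE sub]]; have := edge_le3 H3 eE; rewrite leq_eqVlt => /orP[/eqP c3|].
  right; have : 0 < #|e :\: [set u; v]|.
    by rewrite cardsD (setIidPr sub) c3 cards2 uv.
  case/card_gt0P=> w; rewrite !inE negb_or => /andP[/andP[wu wv] we]; exists w.
  have cuvw : #|[set u; v; w]| = 3.
    by rewrite setUC cardsU1 cards2 uv !inE (negbTE wu) (negbTE wv).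
  have suvw : [set u; v; w] \subset e.
    by rewrite subUset sub sub1set.
  rewrite /tri /= !inE negb_or uv (eq_sym u) (eq_sym v) wu wv /=.
  by have /eqP -> : [set u; v; w] == e; rewrite // eqEcard suvw c3 cuvw.
rewrite ltnS => c2; left; rewrite /dbl uv /=.
by have /eqP -> : [set u; v] == e; rewrite // eqEcard sub cards2 uv.
Qed.

Lemma eval2P u v : eval2_spec u v (eval [:: Some u; Some v]).
Proof.
rewrite /=; case: ifP => [d|nd]; first exact: Eval2Dbl.
case: pickP => [w tr|nt]; first exact: Eval2Tri.
apply: Eval2Zero; have [->|uv] := eqVneq u v; first by left.
right=> /(subhyperedge_pair uv)[|[w]]; first by rewrite nd.
by rewrite nt.
Qed.

Lemma eval2_zero u v : u = v \/ ~ subhyperedge [set u; v] ->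
  [/\ eval [:: Some u; Some v] = NZero & forall w, tri u v w = false].
Proof.
move=> h; have nt w : tri u v w = false.
  case: h => [->|h]; first exact: tri_irr.
  apply/negP => /andP[_ E]; apply: h; split.
    by move/setP/(_ u); rewrite !inE eqxx.
  by exists [set u; v; w] => //; apply/subsetP=> x; rewrite !inE => ->.
split=> //; case: eval2P => // [d|w]; last by rewrite nt.
case: h => [e|]; first by rewrite e dbl_irr in d.
case/andP: d => _ E []; split; last by exists [set u; v].
by move/setP/(_ u); rewrite !inE eqxx.
Qed.

Lemma eval_None s : None \in s -> eval s = NZero.
Proof. by case: s => [//|[a|] [|[b|] [|[c|] []]]]. Qed.

Lemma eval_long s : 3 < size s -> eval s = NZero.
Proof. by case: s => [//|[a|] [|[b|] [|[c|] []]]]. Qed.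

Lemma eval_ctx2 u v u' v' p q :
  eval [:: Some u; Some v] = eval [:: Some u'; Some v'] ->
  (forall x, tri u v x = tri u' v' x) ->
  eval (p ++ [:: Some u; Some v] ++ q) = eval (p ++ [:: Some u'; Some v'] ++ q).
Proof.
move=> e2 e3; have [lt|] := ltnP 1 (size (p ++ q)).
  by rewrite !eval_long // !size_cat /= addnCA !ltnS -size_cat.
case: p q => [|x [|y p]] [|z [|z' q]] //= _.
  by case: z => // z; rewrite e3.
by case: x => // x; rewrite !(tri_swap12 x) !(tri_swap23 _ x) e3.
Qed.

Lemma eval_ctx2_zero u v p q :
  u = v \/ ~ subhyperedge [set u; v] ->
  eval (p ++ [:: Some u; Some v] ++ q) = NZero.
Proof.
move=> /eval2_zero[e2 e3]; have [lt|] := ltnP 1 (size (p ++ q)).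
  by rewrite !eval_long // !size_cat /= addnCA !ltnS -size_cat.
case: p q => [|x [|y p]] [|z [|z' q]] //= _.
  by case: z => // z; rewrite e3.
by case: x => // x; rewrite !(tri_swap12 x) !(tri_swap23 _ x) e3.
Qed.

Lemma edge_seqP (s : seq (vertex H)) : uniq s -> [set x in s] \in edges H ->
  (exists u v, s = [:: u; v] /\ dbl u v) \/
  (exists u v h, s = [:: u; v; h] /\ tri u v h).
Proof.
move=> us E; have := edge_ge2 H3 E; have := edge_le3 H3 E.
rewrite cardsE (card_uniqP us).
case: s us E => [|u [|v [|h [|? ?]]]] //= us E _ _; [left|right].
  exists u, v; split=> //; rewrite /dbl; move: us; rewrite !inE andbT => ->.
  suff -> : [set u; v] = [set x in [:: u; v]] by [].
  by apply/setP=> x; rewrite !inE.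
exists u, v, h; split=> //; apply/andP; split=> //.
suff -> : [set u; v; h] = [set x in [:: u; v; h]] by [].
by apply/setP=> x; rewrite !inE orbA.
Qed.

Lemma eval_edge (s : seq (vertex H)) p q : uniq s -> [set x in s] \in edges H ->
  eval (p ++ map Some s ++ q) = if nilp (p ++ q) then NTop else NZero.
Proof.
move=> us E; case: (edge_seqP us E) => [[u [v [-> d]]]|[u [v [h [-> t]]]]].
  have [lt|] := ltnP 1 (size (p ++ q)).
    rewrite eval_long; last by rewrite !size_cat /= addnCA !ltnS -size_cat.
    by rewrite /nilp; case: (size (p ++ q)) lt.
  case: p q => [|x [|y p]] [|z [|z' q]] //= _; first by rewrite d.
    by case: z => // z; rewrite dbl_tri.
  by case: x => // x; rewrite (tri_swap12 x) (tri_swap23 _ x) dbl_tri.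
have [lt|] := ltnP 0 (size (p ++ q)).
  rewrite eval_long; last by rewrite !size_cat /= addnCA !ltnS -size_cat.
  by rewrite /nilp; case: (size (p ++ q)) lt.
by case: p q => [|x p] [|z q] //= _; rewrite t.
Qed.

Lemma linked_tri u v u' v' x : linked [set u; v] [set u'; v'] ->
  tri u v x -> tri u' v' x.
Proof.
case=> _ _ [w [nw E1 E2]] tr.
move: nw; rewrite !inE !negb_or => /andP[/andP[wu wv] /andP[wu' wv']].
have xw : x = w.
  apply: (tri_uniq tr); case/andP: (tr) => /= /and3P[]; rewrite !inE negb_or.
  by case/andP=> uv _ _ _ _; rewrite /tri /= !inE negb_or uv (eq_sym u) (eq_sym v) wu wv setUC.
subst w; case: (eqVneq u' v') => [e|uv'].
  exfalso; subst v'; have d : dbl x u'.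
    by move: E2; rewrite setUid /dbl wu'.
  by have := dbl_tri1 u v d; rewrite tri_swap12 tri_swap23 tr.
by rewrite /tri /= !inE negb_or uv' (eq_sym u') (eq_sym v') wu' wv' setUC.
Qed.

Lemma linked_sym (s t : {set vertex H}) : linked s t -> linked t s.
Proof. by case=> ? ? [w [? ? ?]]; split=> //; exists w; rewrite setUC. Qed.

Lemma linked_eval u v u' v' : linked [set u; v] [set u'; v'] ->
  eval [:: Some u; Some v] = eval [:: Some u'; Some v'].
Proof.
move=> L; have L' := linked_sym L; case: (L) => su sv [w [nw E1 E2]].
move: nw; rewrite !inE !negb_or => /andP[/andP[wu wv] /andP[wu' wv']].
have [tr|] := boolP (tri u v w).
  by rewrite (eval_tri tr) (eval_tri (linked_tri L tr)).
have [uv|nuv] := eqVneq u v; last first.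
  by rewrite /tri /= !inE negb_or nuv (eq_sym u) (eq_sym v) wu wv setUC E1.
subst v; move=> _; have d : dbl w u by move: E1; rewrite setUid /dbl wu.
have [uv'|nuv'] := eqVneq u' v'.
  subst v'; have d' : dbl w u' by move: E2; rewrite setUid /dbl wu'.
  by rewrite (dbl_uniq d d').
have : tri w u' v'.
  by rewrite tri_swap12 tri_swap23 /tri /= !inE negb_or nuv' (eq_sym u') (eq_sym v') wu' wv' setUC.
by rewrite (dbl_tri1 _ _ d).
Qed.

Lemma eval_cong s t : pres_cong s t -> eval s = eval t.
Proof.
elim=> {s t} [p q l r|l|l r _ ->|l m r _ -> _ ->] //.
have N r' : None \in r' -> eval (p ++ r' ++ q) = NZero.
  by move=> h; apply: eval_None; rewrite !mem_cat h orbT.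
case=> {l r} [u v|u|u||u v h|u v h E|u v u' v' L|s t us ut Es Et].
- apply: eval_ctx2 => [|x]; last exact: tri_swap12.
  rewrite /= dblC; case: ifP => // _.
  by rewrite (@eq_pick _ _ (tri v u)) // => x; exact: tri_swap12.
- by rewrite !N.
- by rewrite !N // !inE orbT.
- by rewrite !N.
- by rewrite eval_ctx2_zero // N.
- have nt : tri u v h = false by rewrite /tri (negbTE E) andbF.
  rewrite [RHS]N //; have [lt|] := ltnP 0 (size (p ++ q)).
    by rewrite eval_long // !size_cat /= addnCA !ltnS -size_cat.
  by case: p q {N} => [|x p] [|z q] //= _; rewrite nt.
- apply: eval_ctx2 => [|x]; first exact: linked_eval.
  by apply/idP/idP; apply: linked_tri => //; exact: linked_sym.
- by rewrite !eval_edge.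
Qed.

Variant eval_spec s : nf -> Prop :=
| EvalZero of pres_cong s [:: None] : eval_spec s NZero
| EvalGen u of s = [:: Some u] : eval_spec s (NGen u)
| EvalDbl u v of s = [:: Some u; Some v] & dbl u v : eval_spec s NTop
| EvalTop u v h of s = [:: Some u; Some v; Some h] & tri u v h : eval_spec s NTop
| EvalCo u v w of s = [:: Some u; Some v] & tri u v w : eval_spec s (NCo w).

Lemma cong_dup u q : pres_cong (Some u :: Some u :: q) [:: None].
Proof.
apply: (@cong_absorb _ [::] q [:: Some u; Some u]).
by apply: cong_pres; apply: pres_pair; left.
Qed.

Lemma cong_tri u v h : ~~ tri u v h ->
  pres_cong [:: Some u; Some v; Some h] [:: None].
Proof.
rewrite negb_and => /orP[/=|/pres_triple/cong_pres //].
rewrite !inE andbT negb_and !negbK => /orP[/orP[]|] /eqP e; subst.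
- exact: cong_dup.
- apply: cong_trans (cong_dup h [:: Some v]).
  exact: (cong_ctx [:: Some h] [::] (cong_swap (Some v) (Some h))).
- exact: (cong_absorb [:: Some u] [::] (cong_dup _ [::])).
Qed.

Lemma evalP s : s != [::] -> eval_spec s (eval s).
Proof.
move=> s0; have [ns|ns] := boolP (None \in s).
  rewrite eval_None //; apply: EvalZero; case/path.splitPr: ns => p q.
  apply: (@cong_absorb _ p q [:: None]); exact: cong_refl.
case: s s0 ns => [//|[u|] [|[v|] [|[h|] [|x q]]]] // _ ns.
- exact: EvalGen.
- case: eval2P => [d|w tr|z]; [exact: EvalDbl d | exact: EvalCo tr|].
  by apply: EvalZero; apply: cong_pres; exact: pres_pair.
- rewrite /=; case: ifPn => [tr|nt]; first exact: EvalTop tr.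
  by apply: EvalZero; exact: cong_tri.
rewrite eval_long //; apply: EvalZero.
case: x ns => [x|]; last by rewrite !inE.
move=> _; have [t1|t1] := boolP (tri u v h); last first.
  exact: (cong_absorb [::] (Some x :: q) (cong_tri t1)).
have [t2|t2] := boolP (tri v h x); last first.
  exact: (cong_absorb [:: Some u] q (cong_tri t2)).
have xu : x = u.
  by move: t1; rewrite tri_swap12 tri_swap23 => /(tri_uniq t2).
subst x; apply: (@cong_absorb _ [::] q [:: Some u; Some v; Some h; Some u]).
apply: cong_trans (cong_catC [:: Some u; Some v; Some h] [:: Some u]) _.
exact: cong_dup.
Qed.

Lemma tri_linked u v u' v' w : tri u v w -> tri u' v' w ->
  linked [set u; v] [set u'; v'].
Proof.
have sub a b : tri a b w -> subhyperedge [set a; b].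
  case/andP=> _ E; split; first by move/setP/(_ a); rewrite !inE eqxx.
  by exists [set a; b; w] => //; apply/subsetP=> x; rewrite !inE => ->.
have nin a b : tri a b w -> w \notin [set a; b].
  case/andP=> /= /and3P[]; rewrite !inE !negb_or => /andP[_ aw] bw _ _.
  by rewrite (eq_sym w a) (eq_sym w b) aw.
move=> t t'; split; [exact: sub t|exact: sub t'|exists w; split].
- by rewrite in_setU negb_or (nin _ _ t) (nin _ _ t').
- by rewrite setUC; case/andP: t.
- by rewrite setUC; case/andP: t'.
Qed.

Lemma dbl_edge u v : dbl u v ->
  uniq [:: u; v] /\ [set x in [:: u; v]] \in edges H.
Proof.
case/andP=> uv E; split; first by rewrite /= inE uv.
suff -> : [set x in [:: u; v]] = [set u; v] by [].
by apply/setP=> x; rewrite !inE.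
Qed.

Lemma tri_edge u v h : tri u v h ->
  uniq [:: u; v; h] /\ [set x in [:: u; v; h]] \in edges H.
Proof.
case/andP=> us E; split=> //.
suff -> : [set x in [:: u; v; h]] = [set u; v; h] by [].
by apply/setP=> x; rewrite !inE orbA.
Qed.

Lemma cong_edge (s t : seq (vertex H)) :
  uniq s /\ [set x in s] \in edges H -> uniq t /\ [set x in t] \in edges H ->
  pres_cong (map Some s) (map Some t).
Proof. by case=> us Es [ut Et]; apply: cong_pres; exact: pres_edge. Qed.

Lemma cong_eval s t : s != [::] -> t != [::] -> eval s = eval t -> pres_cong s t.
Proof.
move=> s0 t0.
case: (evalP s0) => [cs|u ->|u v -> d|u v h -> d|u v w -> d];
case: (evalP t0) => [ct|u' ->|u' v' -> d'|u' v' h' -> d'|u' v' w' -> d'] // e.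
- exact: cong_trans cs (cong_sym ct).
- by case: e => ->; exact: cong_refl.
- exact: (cong_edge (dbl_edge d) (dbl_edge d')).
- exact: (cong_edge (dbl_edge d) (tri_edge d')).
- exact: (cong_edge (tri_edge d) (dbl_edge d')).
- exact: (cong_edge (tri_edge d) (tri_edge d')).
- case: e => e; subst w'; apply: cong_pres; apply: pres_linked.
  exact: tri_linked d d'.
Qed.

Lemma edge_prod_neq0 (s : seq (vertex H)) : uniq s -> [set x in s] \in edges H ->
  ~ pres_cong (map Some s) [:: None].
Proof.
move=> us E /eval_cong; have := eval_edge [::] [::] us E.
by rewrite /= cats0 => ->.
Qed.

Lemma cat_eq2 p s (x y : gen H) : p != [::] -> s != [::] -> p ++ s = [:: x; y] ->
  p = [:: x] /\ s = [:: y].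
Proof. by case: p => [|a [|b [|c p]]] //; case: s => [|d [|e s]] // _ _ [] // -> ->. Qed.

Lemma cat_eq3 p s (x y z : gen H) :
  p != [::] -> s != [::] -> p ++ s = [:: x; y; z] ->
  p = [:: x] /\ s = [:: y; z] \/ p = [:: x; y] /\ s = [:: z].
Proof.
case: p => [|a [|b [|c [|c' p]]]] //; case: s => [|d [|e [|f s]]] // _ _ [] // -> -> ->.
  by left.
by right.
Qed.

Lemma eval_cancl p s t : p != [::] -> s != [::] -> t != [::] ->
  eval (p ++ s) = eval (p ++ t) -> eval (p ++ s) <> NZero -> eval s = eval t.
Proof.
have ne q : p != [::] -> p ++ q != [::] by case: p.
move=> p0 s0 t0.
case: (evalP (ne s p0)) => [//|u es|u v es d|u v h es d|u v w es d];
case: (evalP (ne t p0)) => [//|u' et|u' v' et d'|u' v' h' et d'|u' v' w' et d'] // e _.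
- by case: p p0 s s0 es {ne et} => [|? [|? ?]] // _ [].
- have [ep ->] := cat_eq2 p0 s0 es; have [ep' ->] := cat_eq2 p0 t0 et.
  by move: ep'; rewrite ep => -[eu]; move: d'; rewrite -eu => /(dbl_uniq d) ->.
- have [ep _] := cat_eq2 p0 s0 es.
  have [] := cat_eq3 p0 t0 et; rewrite ep => -[] // [eu] _.
  by move: d'; rewrite -eu (dbl_tri1 _ _ d).
- have [ep _] := cat_eq2 p0 t0 et.
  have [] := cat_eq3 p0 s0 es; rewrite ep => -[] // [eu] _.
  by move: d; rewrite -eu (dbl_tri1 _ _ d').
- have [] := cat_eq3 p0 s0 es => -[ep ->];
  have [] := cat_eq3 p0 t0 et; rewrite ep => -[] // [].
    move=> eu ->; move: d d'; rewrite -eu => d d'.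
    rewrite (tri_swap12 u) (tri_swap23 v) in d; rewrite (tri_swap12 u) (tri_swap23 v') in d'.
    by rewrite (eval_tri d) (eval_tri d').
  by move=> eu ev ->; move: d'; rewrite -eu -ev => /(tri_uniq d) ->.
have [ep ->] := cat_eq2 p0 s0 es; have [ep' ->] := cat_eq2 p0 t0 et.
move: ep' e; rewrite ep => -[eu] [ew]; move: d'; rewrite -eu -ew.
by rewrite (tri_swap23 u v') => d'; rewrite (tri_swap23 u v) in d; rewrite (tri_uniq d d').
Qed.

End ZeroCancellative.

Section SGTheory.
Variable H : hypergraph.

Lemma SG_pi_mul (x y : word H) :
  SG_mul (\pi_(SG H) x) (\pi_(SG H) y) = \pi_(SG H) (word_cat x y).
Proof.
have rep (x' : word H) : pres_cong (val (repr (\pi_(SG H) x'))) (val x').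
  by apply/asboolP; apply/(@eqmodP _ (word_equiv H)); rewrite reprK.
by apply/eqmodP/asboolP; exact: cong_cat.
Qed.

Lemma SG_piP (x y : word H) :
  \pi_(SG H) x = \pi_(SG H) y <-> pres_cong (val x) (val y).
Proof.
split=> h; last by apply/(@eqmodP _ (word_equiv H))/asboolP.
by apply/asboolP; apply/(@eqmodP _ (word_equiv H)).
Qed.

Lemma SG_mulA : associative (@SG_mul H).
Proof.
elim/quotW=> x; elim/quotW=> y; elim/quotW=> z.
rewrite (SG_pi_mul y z) (SG_pi_mul x y) !SG_pi_mul.
by apply/SG_piP; rewrite /= catA; exact: cong_refl.
Qed.

Lemma SG_mulC : commutative (@SG_mul H).
Proof.
elim/quotW=> x; elim/quotW=> y; rewrite !SG_pi_mul.
by apply/SG_piP; exact: cong_catC.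
Qed.

Lemma SG_mul0z : left_zero (SG_zero H) (@SG_mul H).
Proof.
elim/quotW=> x; rewrite /SG_zero /SG_gen SG_pi_mul.
by apply/SG_piP; exact: cong_0l.
Qed.

Lemma SG_mulz0 : right_zero (SG_zero H) (@SG_mul H).
Proof. by move=> x; rewrite SG_mulC SG_mul0z. Qed.

Hypothesis H3 : is_3hypergraph H.

Lemma SG_cancl (x y z : SG H) :
  SG_mul x y = SG_mul x z -> SG_mul x y != SG_zero H -> y = z.
Proof.
elim/quotW: x => x; elim/quotW: y => y; elim/quotW: z => z.
rewrite !SG_pi_mul => /SG_piP e /eqP n0; apply/SG_piP.
apply: (cong_eval H3 (valP y) (valP z)).
apply: (eval_cancl H3 (valP x) (valP y) (valP z)); first exact: (eval_cong H3 e).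
move=> e0; apply: n0; apply/SG_piP.
exact: (@cong_eval H H3 _ [:: None] (valP (word_cat x y)) isT e0).
Qed.

Lemma SG_cancr (x y z : SG H) :
  SG_mul y x = SG_mul z x -> SG_mul y x != SG_zero H -> y = z.
Proof. by rewrite !(SG_mulC _ x); exact: SG_cancl. Qed.

End SGTheory.

Definition hypergraph_semiring (H : hypergraph3) : semiring :=
  flat_semiring (@SG_mulA H) (@SG_mul0z H) (@SG_mulz0 H)
    (SG_cancl (hgraph3P H)) (SG_cancr (hgraph3P H)).

(* Main.v *)
(** Substitute in [S_H] the generators of the 2-edges: fix a 3-edge {x,y,z} and,
    for every orientation [k] of the 2-edges, send one end of each 2-edge to
    [a_x] and the other to [a_y a_z], leaving the vertices of 3-edges alone.  A
    word vanishes in [S_H] iff some orientation makes it vanish, and nonzero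
    words are equal in [S_H] iff all orientations make them equal.  Hence [S_H]
    is obtained from a power of the semiring of the 3-edges of [H] by taking a
    subalgebra and collapsing the tuples having a zero coordinate. *)
Require Import Defs.
From mathcomp Require Import all_boot.
From mathcomp Require Import boolp.

Set Implicit Arguments.
Unset Strict Implicit.
Unset Printing Implicit Defensive.

(** * Closure of varieties under homomorphic images of subalgebras *)

Section Divisor.
Variables (A S : semiring) (R : A -> S -> Prop).
Hypotheses (Rfun : forall a x y, R a x -> R a y -> x = y)
  (Rsurj : forall x, exists a, R a x)
  (Radd : forall a b x y, R a x -> R b y -> R (sadd a b) (sadd x y))
  (Rmul : forall a b x y, R a x -> R b y -> R (smul a b) (smul x y)).

Let B := {a : A | exists x, R a x}.

Let B_eq (a b : B) : sval a = sval b -> a = b.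
Proof. by case: a b => [a ha] [b hb] /= e; subst b; congr exist; exact: Prop_irrelevance. Qed.

Let B_add (a b : B) : B.
Proof.
exists (sadd (sval a) (sval b)).
by case: (svalP a) (svalP b) => x ax [y bY]; exists (sadd x y); exact: Radd.
Defined.

Let B_mul (a b : B) : B.
Proof.
exists (smul (sval a) (sval b)).
by case: (svalP a) (svalP b) => x ax [y bY]; exists (smul x y); exact: Rmul.
Defined.

Let B_nonempty : inhabited B.
Proof.
case: (scar_nonempty S) => x; have [a ax] := Rsurj x.
by apply: inhabits; exists a, x.
Qed.

Let B_addA : associative B_add.
Proof. by move=> a b c; apply: B_eq; exact: saddA. Qed.

Let B_addC : commutative B_add.
Proof. by move=> a b; apply: B_eq; exact: saddC. Qed.

Let B_mulA : associative B_mul.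
Proof. by move=> a b c; apply: B_eq; exact: smulA. Qed.

Let B_mulDl : left_distributive B_mul B_add.
Proof. by move=> a b c; apply: B_eq; exact: smulDl. Qed.

Let B_mulDr : right_distributive B_mul B_add.
Proof. by move=> a b c; apply: B_eq; exact: smulDr. Qed.

Let B_semiring := Semiring B_nonempty B_addA B_addC B_mulA B_mulDl B_mulDr.

(** The domain of [R] is a subalgebra of [A], and on it [R] is the graph of a homomorphism onto
    [S]. *)
Lemma variety_divisor (C : semiring -> Prop) : is_variety C -> C A -> C S.
Proof.
case=> quo sub _ CA.
pose h (b : B_semiring) : S := sval (cid (svalP b)).
have hP (b : B_semiring) : R (sval b) (h b) by exact: svalP (cid (svalP b)).
apply: (quo B_semiring S h).
- split=> a b; apply: (Rfun (hP _)); first exact: Radd (hP a) (hP b).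
  exact: Rmul (hP a) (hP b).
- move=> x; have [a ax] := Rsurj x.
  exists (exist _ a (ex_intro _ x ax)); exact: (Rfun (hP (exist _ a _)) ax).
- apply: (sub A B_semiring sval) => //; exact: B_eq.
Qed.

End Divisor.

(** * Substitution of nonempty words for generators *)

Section Substitution.
Variables (G H : hypergraph) (f : vertex H -> seq (vertex G)).

Definition subst_gen (g : gen H) : seq (gen G) :=
  if g is Some u then map Some (f u) else [:: None].

Definition subst (s : seq (gen H)) : seq (gen G) := flatten (map subst_gen s).

Lemma subst_cat s t : subst (s ++ t) = subst s ++ subst t.
Proof. by rewrite /subst map_cat flatten_cat. Qed.

Hypothesis f_neq0 : forall u, f u != [::].

Lemma subst_gen_neq0 g : subst_gen g != [::].
Proof. by case: g => //= u; case: (f u) (f_neq0 u). Qed.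

Lemma subst_neq0 s : s != [::] -> subst s != [::].
Proof. by case: s => // g s _; rewrite /subst /=; case: (subst_gen g) (subst_gen_neq0 g). Qed.

Lemma size_subst s : size s <= size (subst s).
Proof.
elim: s => //= g s IH; rewrite /subst /= size_cat.
by case: (subst_gen g) (subst_gen_neq0 g) => //= g' t _; rewrite addSn ltnS (leq_trans IH) ?leq_addl.
Qed.

Definition word_subst (w : word H) : word G :=
  exist (fun w => w != [::]) _ (subst_neq0 (valP w)).

End Substitution.

(** * A family of substitutions exhibits one hypergraph semiring as a divisor of a power of
    another *)

Section FlatDivisor.
Variables (G H : hypergraph3) (K : Type).
Variable f : K -> vertex H -> seq (vertex G).
Hypothesis f_neq0 : forall k u, f k u != [::].
Hypothesis subst_zero : forall s, s != [::] ->
  (eval s = NZero H <-> exists k, eval (subst (f k) s) = NZero G).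
Hypothesis subst_inj : forall s t, s != [::] -> t != [::] ->
  eval s <> NZero H -> eval t <> NZero H ->
  (eval s = eval t <-> forall k, eval (subst (f k) s) = eval (subst (f k) t)).

Let psi k (w : word H) : SG G := \pi_(SG G)%qT (word_subst (f_neq0 k) w).
Let pi (w : word H) : SG H := \pi_(SG H)%qT w.

Let pi_eqE (F : hypergraph3) (v w : word F) :
  (\pi_(SG F)%qT v = \pi_(SG F)%qT w) <-> eval (val v) = eval (val w).
Proof.
split=> [/SG_piP|e]; first exact: (eval_cong (hgraph3P F)).
by apply/SG_piP; exact: (cong_eval (hgraph3P F) (valP v) (valP w)).
Qed.

Let pi_zero (F : hypergraph3) (w : word F) :
  (\pi_(SG F)%qT w = SG_zero F) <-> eval (val w) = NZero F.
Proof. exact: pi_eqE. Qed.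

Let psi_zero w : pi w = SG_zero H <-> exists k, psi k w = SG_zero G.
Proof.
rewrite pi_zero (subst_zero (valP w)).
by split=> -[k e]; exists k; apply/(pi_zero (word_subst (f_neq0 k) w)).
Qed.

(** A common zero coordinate makes both classes zero; without one, both are nonzero and [subst_inj]
    applies. *)
Let psi_inj v w : (forall k, psi k v = psi k w) -> pi v = pi w.
Proof.
move=> e; case: (pselect (exists k, psi k v = SG_zero G)) => [z|nz].
  have z' : exists k, psi k w = SG_zero G by case: z => k <-; exists k; rewrite e.
  by move/psi_zero: z => ->; move/psi_zero: z' => ->.
apply/pi_eqE/subst_inj; rewrite ?(valP v) ?(valP w) //.
- by move/pi_zero/psi_zero.
- by move/pi_zero/psi_zero => -[k]; rewrite -e => z; apply: nz; exists k.
- by move=> k; exact: (pi_eqE _ _).1 (e k).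
Qed.

(** The class has to be nonzero: two zero words may vanish at different coordinates. *)
Let pi_inj v w : pi v = pi w -> pi v <> SG_zero H -> forall k, psi k v = psi k w.
Proof.
move=> e nz k; apply/(pi_eqE (word_subst _ v) (word_subst _ w)); move: k; apply/subst_inj; rewrite ?(valP v) ?(valP w) //.
- by move/pi_zero.
- by rewrite e in nz; move/pi_zero.
- by apply/pi_eqE.
Qed.

Let psi_mul k v w : psi k (word_cat v w) = SG_mul (psi k v) (psi k w).
Proof. by rewrite SG_pi_mul; apply/pi_eqE; rewrite /= subst_cat. Qed.

(** The relation [R] sends every tuple with a zero coordinate to zero and the tuple of a word to the
    class of that word. Tuples with a zero coordinate absorb both sums and products, so only sums of
    two word tuples need care. *)
Lemma variety_subst (C : semiring -> Prop) : is_variety C ->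
  C (hypergraph_semiring G) -> C (hypergraph_semiring H).
Proof.
move=> vC CG; have CP : C (semiring_prod (fun _ : K => hypergraph_semiring G)).
  by case: (vC) => _ _; apply.
pose zc (a : K -> SG G) := exists k, a k = SG_zero G.
pose R (a : K -> SG G) (x : SG H) :=
  (zc a /\ x = SG_zero H) \/ (exists2 w, (forall k, a k = psi k w) & x = pi w).
(* The two clauses of [R] overlap; this shows that they agree there. *)
have Rz a w : zc a -> (forall k, a k = psi k w) -> pi w = SG_zero H.
  by move=> [k ak] aw; apply/psi_zero; exists k; rewrite -aw.
apply: (@variety_divisor (semiring_prod (fun _ : K => hypergraph_semiring G))
  (hypergraph_semiring H) R) vC CP.
- move=> a x y [[za ->]|[w aw ->]] [[zb ->]|[w' aw' ->]] //.
  + by rewrite (Rz a).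
  + by rewrite (Rz a).
  + by apply: psi_inj => k; rewrite -aw aw'.
- elim/quotW=> w; exists (fun k => psi k w); right; by exists w.
- have addz a b x y : zc a -> x = SG_zero H ->
    R (fun k => flat_add (SG_zero G) (a k) (b k)) (flat_add (SG_zero H) x y).
    move=> [k ak] ->; left; split; last by rewrite /flat_add; case: eqP.
    by exists k; rewrite ak /flat_add; case: eqP.
  move=> a b x y; rewrite /= => Ra Rb.
  case: (Ra) => [[za x0]|[w aw xw]]; first exact: addz.
  case: (Rb) => [[zb y0]|[w' bw' yw']].
    rewrite [flat_add _ x y]flat_addC.
    have := addz b a y x zb y0; congr R; apply: functional_extensionality_dep => k.
    exact: flat_addC.
  (* Equal tuples are idempotent under addition; unequal ones differ at some [k], where their flat
     sum is zero. *)
  have [e|/existsNP[k ne]] := pselect (forall k, psi k w = psi k w').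
    right; exists w; last by rewrite xw yw' (psi_inj e) /flat_add eqxx.
    by move=> k; rewrite aw bw' -e /flat_add eqxx.
  left; split; first by exists k; rewrite aw bw' /flat_add; case: eqP.
  (* If the classes coincide although the tuples differ, [pi_inj] forces their common value to be
     zero. *)
  rewrite xw yw' /flat_add; case: eqP => // e.
  by case: (pselect (pi w = SG_zero H)) => // nz; case: ne; exact: pi_inj.
- move=> a b x y [[[k ak] ->]|[w aw ->]].
    by move=> _; left; split; [exists k; rewrite /= ak; exact: SG_mul0z | exact: SG_mul0z].
  case=> [[[k bk] ->]|[w' bw' ->]].
    by left; split; [exists k; rewrite /= bk; exact: SG_mulz0 | exact: SG_mulz0].
  right; exists (word_cat w w') => [k|]; last by rewrite /= /pi SG_pi_mul.
  by rewrite psi_mul -aw -bw'.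
Qed.

End FlatDivisor.

(** * Hyperedges of size two and three *)

Section Edges.
Variable H : hypergraph.
Implicit Types u v w : vertex H.

(** [edge3] and [edge2] are global counterparts, with the same bodies, of the section-local [tri]
    and [dbl] on which [eval] is built. *)
Definition edge3 u v w := uniq [:: u; v; w] && ([set u; v; w] \in edges H).
Definition edge2 u v := (u != v) && ([set u; v] \in edges H).
Definition in_edge3 u := [exists e in edges H, (#|e| == 3) && (u \in e)].

Hypothesis H3 : is_3hypergraph H.

Lemma eval_catC (s t : seq (gen H)) : eval (s ++ t) = eval (t ++ s).
Proof. exact: (eval_cong H3 (cong_catC s t)). Qed.

Lemma edge3_rot u v w : edge3 u v w = edge3 v w u.
Proof. by rewrite /edge3 -(rot_uniq 1) -setUA setUC. Qed.

Lemma card3_edge3 (e : {set vertex H}) : e \in edges H -> #|e| = 3 ->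
  exists u v w, edge3 u v w /\ e = [set u; v; w].
Proof.
move=> E c; have := enum_uniq (mem e); have : size (enum e) = 3 by rewrite -cardE.
have := set_enum e; case: (enum e) => [|u [|v [|w []]]] //= def_e _ us.
have {}def_e : e = [set u; v; w] by rewrite -def_e; apply/setP=> x; rewrite !inE orbA.
by exists u, v, w; split=> //; rewrite /edge3 -def_e E andbT.
Qed.

Lemma edge3_in u v w : edge3 u v w -> in_edge3 u.
Proof.
move=> t; apply/existsP; exists [set u; v; w]; case/andP: (t) => _ ->.
by rewrite (tri_card t) !inE !eqxx.
Qed.

Lemma in_edge3P u : in_edge3 u -> exists v w, edge3 u v w.
Proof.
case/existsP=> e /and3P[E /eqP c]; have [a [b [d [t ->]]]] := card3_edge3 E c.
rewrite !inE => /orP[/orP[]|] /eqP ->; first by exists b, d.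
  by exists d, a; rewrite -edge3_rot.
by exists a, b; rewrite edge3_rot.
Qed.

Lemma edge2C u v : edge2 u v = edge2 v u.
Proof. by rewrite /edge2 eq_sym setUC. Qed.

Lemma edge2_in u v : edge2 u v -> in_edge3 u = false.
Proof. by move=> d; apply/negbTE/negP => /in_edge3P[a [b]]; rewrite /edge3 (dbl_tri1 H3 a b d). Qed.

End Edges.

(** * The 3-uniform hypergraph formed by the 3-edges *)

Section Core.
Variable H : hypergraph3.
Let H3 := hgraph3P H.

Definition core_vertex : finType := {u : vertex H | in_edge3 u}.

Definition core_edges : {set {set core_vertex}} :=
  [set e : {set core_vertex} | (#|e| == 3) && (val @: e \in edges H)].

Definition core_hypergraph : hypergraph := Hypergraph core_edges.

Lemma core_uniform3 : uniform3 core_hypergraph.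
Proof. by move=> e; rewrite inE => /andP[/eqP]. Qed.

Lemma edge3_core (u v w : core_vertex) :
  @edge3 core_hypergraph u v w = edge3 (val u) (val v) (val w).
Proof.
have eq_uniq := map_inj_uniq val_inj [:: u; v; w].
rewrite /edge3 (eq_uniq : uniq [:: val u; val v; val w] = _).
rewrite [_ \in edges core_hypergraph]inE !imsetU !imset_set1.
case us: (uniq [:: u; v; w]) => //=; suff -> : #|[set u; v; w]| = 3 by [].
move: us; rewrite /= !inE negb_or => /andP[/andP[uv uw] /andP[vw _]].
by rewrite setUC cardsU1 cards2 uv !inE (eq_sym w u) (eq_sym w v) (negbTE uw) (negbTE vw).
Qed.

Lemma core_edge_ex (u v w : vertex H) : edge3 u v w ->
  exists u' v' w' : core_vertex, [/\ u = val u', v = val v', w = val w' &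
    @edge3 core_hypergraph u' v' w'].
Proof.
move=> t; have t' : edge3 v w u by rewrite -edge3_rot.
have t'' : edge3 w u v by rewrite edge3_rot.
exists (Sub u (edge3_in t)), (Sub v (edge3_in t')), (Sub w (edge3_in t'')).
by rewrite edge3_core !SubK.
Qed.

(** Linearity passes along the injection [val]; covering holds because core vertices are by
    definition those in 3-edges; the clause on 2-edges is vacuous. *)
Lemma core_is_3hypergraph : is_3hypergraph core_hypergraph.
Proof.
have E3 (e : {set core_vertex}) : e \in core_edges -> #|e| = 3 by exact: core_uniform3.
split.
- move=> e f; rewrite !inE => /andP[_ E] /andP[_ F] ef.
  rewrite -(card_imset _ val_inj) imsetI; last by move=> ? ? _ _; exact: val_inj.
  by apply: (edge_linear H3 E F); rewrite (inj_eq (imset_inj val_inj)).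
- move=> u; have [v [w /core_edge_ex[u' [v' [w' [/val_inj <- _ _ t]]]]]] := in_edge3P (valP u).
  by exists [set u; v'; w']; [case/andP: t | rewrite !inE eqxx].
- by move=> e /E3 ->.
- by move=> e f /E3 ->.
- by move=> e /E3 ->.
have [e E c] := edge_eq3 H3; have [u [v [w [/core_edge_ex t _]]]] := card3_edge3 E c.
case: t => u' [v' [w' [_ _ _ /andP[_ F]]]].
by exists [set u'; v'; w'] => //; exact: E3.
Qed.

Definition core : hypergraph3 := Hypergraph3 core_is_3hypergraph.

Definition nf_val (r : nf core) : nf H :=
  match r with
  | NZero => NZero H
  | NTop => NTop H
  | NGen u => @NGen H (val u)
  | NCo w => @NCo H (val w)
  end.

Lemma nf_val_inj : injective nf_val.
Proof. by case=> [||u|u] [||v|v] //= [/val_inj ->]. Qed.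

Lemma nf_val_zero r : nf_val r = NZero H <-> r = NZero core.
Proof. by split=> [|->//]; case: r. Qed.

(** The delicate case is a pair that vanishes in the core. In [H] it is no 2-edge, since those avoid
    the vertices of 3-edges, and it lies in no 3-edge, since that would be a 3-edge of the core. *)
Lemma eval_core (s : seq (gen core)) : eval (map (omap val) s) = nf_val (eval s).
Proof.
have [ns|ns] := boolP (None \in s).
  by rewrite !eval_None //; apply/mapP; exists None.
have [long|] := ltnP 3 (size s); first by rewrite !eval_long // size_map.
case: s ns => [|[u|] [|[v|] [|[w|] []]]] // _ _.
- rewrite [map _ _]/=; case: (eval2P (hgraph3P core) u v) => [d|w t|z].
  + by case/andP: d => uv /core_uniform3; rewrite cards2 uv.
  + by apply: (eval_tri H3); move: t; rewrite -!/(edge3 _ _ _) edge3_core.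
  have [_ nt] := eval2_zero (hgraph3P core) z.
  case: (eval2P H3) => // [d|w t].
    by have := edge2_in H3 d; rewrite (valP u).
  case: (core_edge_ex t) => u' [v' [w' [/val_inj eu /val_inj ev _]]].
  by rewrite -eu -ev /edge3 nt.
- rewrite /= -!/(edge3 _ _ _).
  have := edge3_core u v w; rewrite /edge3 /= => ->.
  by case: ifP.
Qed.

Lemma subst_val (s : seq (gen core)) :
  subst (fun u : vertex core => [:: val u]) s = map (omap val) s.
Proof. by elim: s => //= -[u|] s <-. Qed.

(** One substitution suffices here, hence the index type [unit]: the inclusion of the core preserves
    and reflects normal forms. *)
Lemma variety_core C : is_variety C ->
  C (hypergraph_semiring H) -> C (hypergraph_semiring core).
Proof.
apply: (variety_subst (f := fun (_ : unit) (u : vertex core) => [:: val u])) => //.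
- move=> s _; split=> [e|[_]]; last by rewrite subst_val eval_core => /nf_val_zero.
  by exists tt; rewrite subst_val eval_core e.
- move=> s t _ _ _ _; split=> [e _|/(_ tt)]; rewrite !subst_val !eval_core ?e //.
  exact: nf_val_inj.
Qed.

End Core.

(** * Orientations of the 2-edges and the induced substitutions *)

Section Splitting.
Variable H : hypergraph3.
Let H3 := hgraph3P H.
Implicit Types (u v w : vertex H) (s t : seq (gen H)).

Definition orientation (k : vertex H -> bool) : Prop :=
  forall u v, edge2 u v -> k v = ~~ k u.

Lemma orientation_exists : exists k, orientation k.
Proof.
(* [p u] is the other end of the 2-edge at [u], or [u] itself by default. Comparing the ranks of
   both ends orients the edge. *)
pose p u := odflt u [pick v | edge2 u v].
have pE u v : edge2 u v -> p u = v.
  move=> d; rewrite /p; case: pickP => [v' d'|/(_ v)]; last by rewrite d.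
  by apply: (dbl_uniq H3 d' d).
exists (fun u => enum_rank u < enum_rank (p u)) => u v d.
rewrite (pE _ _ d) (pE v u) 1?edge2C // -leqNgt [RHS]leq_eqVlt.
by rewrite (inj_eq val_inj) (inj_eq enum_rank_inj) eq_sym; case/andP: d => /negbTE ->.
Qed.

(** The 2-edges are disjoint, so the one at [u] can be reoriented alone. *)
Lemma orientation_flip k u b : orientation k -> exists k',
  [/\ orientation k', k' u = b &
      forall v, v != u -> ~~ edge2 v u -> k' v = k v].
Proof.
(* [k u (+) b] tells whether a flip is required, and the last factor restricts it to [u] and its
   partner. *)
move=> ok; exists (fun v => k v (+) ((k u (+) b) && ((v == u) || edge2 v u))).
split=> [v w d||v vu nd].
- rewrite (ok _ _ d) addNb; congr (~~ (_ (+) (_ && _))).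
  have eqd a c : edge2 a c -> (a == u) || edge2 a u -> (c == u) || edge2 c u.
    move=> ac /orP[/eqP ea|au]; first by rewrite -ea (edge2C c) ac orbT.
    by rewrite (dbl_uniq H3 ac au) eqxx.
  by apply/idP/idP; apply: eqd => //; rewrite edge2C.
- by rewrite eqxx andbT addbA addbb.
- by rewrite (negbTE vu) (negbTE nd) andbF addbF.
Qed.

Lemma orientation_at u b : exists2 k, orientation k & k u = b.
Proof.
have [k ok] := orientation_exists.
by have [k' [ok' e _]] := orientation_flip u b ok; exists k'.
Qed.

Lemma orientation_eq u v : ~~ edge2 u v -> exists2 k, orientation k & k u = k v.
Proof.
move=> nd; have [k ok] := orientation_exists.
have [->|uv] := eqVneq u v; first by exists k.
have [k' [ok' e e']] := orientation_flip v (k u) ok.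
by exists k'; rewrite // e e'.
Qed.

Lemma orientation_neq u v : u != v -> exists2 k, orientation k & k u <> k v.
Proof.
move=> uv; have [k ok] := orientation_exists.
have [d|nd] := boolP (edge2 u v).
  by exists k; rewrite // (ok _ _ d); case: (k u).
have [k' [ok' e e']] := orientation_flip v (~~ k u) ok.
by exists k'; rewrite // e e' //; case: (k u).
Qed.

Variables x y z : vertex H.
Hypothesis xyz : edge3 x y z.

Definition split_edge2 (k : vertex H -> bool) u : seq (vertex H) :=
  if in_edge3 u then [:: u] else if k u then [:: x] else [:: y; z].

(** The effect of the substitution on nonzero normal forms. [NCo x] is the value of [y z], and only
    single generators can change. *)
Definition split_nf (k : vertex H -> bool) (r : nf H) : nf H :=
  if r is NGen u then
    if in_edge3 u then NGen u else if k u then NGen x else @NCo H x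
  else r.

Lemma split_edge2_neq0 k u : split_edge2 k u != [::].
Proof. by rewrite /split_edge2; case: ifP => // _; case: ifP. Qed.

Lemma eval_yz : eval [:: Some y; Some z] = @NCo H x.
Proof. by apply: (eval_tri H3); rewrite -/(edge3 _ _ _) -edge3_rot. Qed.

Lemma eval_diag u : eval [:: Some u; Some u] = NZero H.
Proof. by have [] := eval2_zero H3 (or_introl (erefl u)). Qed.

Lemma eval_edge3 u v w : edge3 u v w -> eval [:: Some u; Some v; Some w] = NTop H.
Proof. by move=> t; rewrite /= -/(edge3 _ _ _) t. Qed.

(** A 2-edge becomes the 3-edge [x y z] up to order, which has the same product; the other nonzero
    words of length two or three have all their letters in 3-edges and stay fixed. *)
Lemma eval_split k s : orientation k -> s != [::] -> eval s <> NZero H ->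
  eval (subst (split_edge2 k) s) = split_nf k (eval s).
Proof.
move=> ok s0; case: (evalP H3 s0) => [//|u ->|u v -> d|u v w -> t|u v w -> t] _.
- rewrite /subst /= /split_edge2 cats0.
  by case: ifP => // _; case: ifP => // _; rewrite eval_yz.
- have d' : edge2 v u by rewrite edge2C.
  rewrite /subst /= /split_edge2 cats0 (edge2_in H3 d) (edge2_in H3 d') (ok _ _ d).
  case: (k u) => /=; first exact: eval_edge3 xyz.
  exact: etrans (eval_catC H3 [:: Some y; Some z] [:: Some x]) (eval_edge3 xyz).
- have t' : edge3 v w u by rewrite -edge3_rot.
  have t'' : edge3 w u v by rewrite edge3_rot.
  rewrite /subst /= /split_edge2 (edge3_in t) (edge3_in t') (edge3_in t'').
  exact: eval_edge3.
- have t' : edge3 v w u by rewrite -edge3_rot.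
  rewrite /subst /= /split_edge2 (edge3_in t) (edge3_in t').
  exact: (eval_tri H3 t).
Qed.

(** If [u] is in a 3-edge, send [v] to [x] when [u = x], giving a square, and to [y z] otherwise,
    where linearity makes [u y z] zero. If [u] is in none, give [u] and [v] the same image, whose
    square is zero. *)
Lemma split_zero_pair u v : ~~ in_edge3 v -> eval [:: Some u; Some v] = NZero H ->
  exists2 k, orientation k & eval (subst (split_edge2 k) [:: Some u; Some v]) = NZero H.
Proof.
move=> nv e0; have sE k : subst (split_edge2 k) [:: Some u; Some v] =
    map Some (split_edge2 k u) ++ (if k v then [:: Some x] else [:: Some y; Some z]).
  by rewrite /subst /= cats0 /split_edge2 (negbTE nv); case: (k v).
have [cu|nu] := boolP (in_edge3 u).
  have [ux|ux] := eqVneq u x.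
    have [k ok kv] := orientation_at v true; exists k => //.
    by rewrite sE kv /split_edge2 cu ux; exact: eval_diag.
  have [k ok kv] := orientation_at v false; exists k => //.
  rewrite sE kv /split_edge2 cu /= -/(edge3 _ _ _); case: ifP => // t.
  case/eqP: ux; apply: (tri_uniq H3 (u := y) (v := z)); rewrite -/(edge3 _ _ _).
    by rewrite -edge3_rot.
  by rewrite -edge3_rot.
have nd : ~~ edge2 u v by apply/negP => d; rewrite (eval_dbl d) in e0.
have [k ok kuv] := orientation_eq nd; exists k => //.
by rewrite sE -kuv /split_edge2 (negbTE nu); case: (k u) => //; exact: eval_diag.
Qed.

Lemma split_zero s : s != [::] -> eval s = NZero H ->
  exists2 k, orientation k & eval (subst (split_edge2 k) s) = NZero H.
Proof.
move=> s0 e0; have [ns|ns] := boolP (None \in s).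
  have [k ok] := orientation_exists; exists k => //.
  by apply: eval_None; apply/flattenP; exists [:: None]; rewrite ?inE //; apply/mapP; exists None.
have [cs|] := boolP (all (fun g => if g is Some u then in_edge3 u else true) s).
  have [k ok] := orientation_exists; exists k => //.
  suff -> : subst (split_edge2 k) s = s by [].
  elim: s ns cs {s0 e0} => //= -[u|//] s IH; rewrite inE => /= ns /andP[cu cs].
  by rewrite /subst /= /split_edge2 cu /= -/(split_edge2 k) -/(subst _ s) IH.
(* In a word of length at least 3, sending [u] to the two letters [y z] yields length at least 4,
   where everything is zero. *)
case/allPn => -[u|//] us nu; have [lt2|ge2] := ltnP (size s) 3; last first.
  have [k ok ku] := orientation_at u false; exists k => //; apply: eval_long.
  case/path.splitPr: us ge2 => p q; rewrite size_cat /= addnS ltnS => le_pq.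
  rewrite subst_cat size_cat /subst /= -/(subst _ q) /split_edge2 (negbTE nu) ku /=.
  rewrite -/(split_edge2 k) !addnS !ltnS; apply: leq_trans le_pq _.
  apply: leq_add; apply: size_subst; exact: split_edge2_neq0.
(* A single generator is nonzero, so only pairs remain, with [u] in either position. *)
case: s s0 ns us lt2 e0 => [|[a|] [|[b|] []]] //= _ _ + _ e0.
rewrite !inE => /orP[] /eqP[ea]; subst u; last exact: split_zero_pair nu e0.
have [|k ok e] := split_zero_pair (u := b) nu.
  by rewrite -e0; exact: (eval_catC H3 [:: Some b] [:: Some a]).
exists k => //; rewrite -e (subst_cat _ [:: Some a] [:: Some b]).
by rewrite (eval_catC H3) -subst_cat.
Qed.

Lemma split_nf_zero k r : split_nf k r = NZero H -> r = NZero H.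
Proof. by case: r => //= u; case: ifP => // _; case: ifP. Qed.

Lemma split_nf_inj r r' :
  (forall k, orientation k -> split_nf k r = split_nf k r') -> r = r'.
Proof.
have [k0 ok0] := orientation_exists.
(* With [k u] true the image of a generator is again a generator, while [split_nf] fixes every other
   normal form. *)
have genN u q : (forall v, q <> NGen v) ->
    ~ (forall k, orientation k -> split_nf k (NGen u) = split_nf k q).
  move=> nq; have [k ok ku] := orientation_at u true => /(_ k ok).
  have [v ->] : exists v, split_nf k (NGen u) = NGen v.
    by rewrite /= ku; case: ifP => _; [exists u | exists x].
  by case: q nq => //= w /(_ w).
case: r r' => [||u|w] [||u'|w'] e //; try exact: (e _ ok0).
- by case: (@genN u' (NZero H)) => // k ok; rewrite e.
- by case: (@genN u' (NTop H)) => // k ok; rewrite e.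
- by case: (@genN u (NZero H)).
- by case: (@genN u (NTop H)).
- have [->//|uu'] := eqVneq u u'; exfalso.
  (* With [k v'] false, [v'] either stays put or becomes [NCo x]; neither is the generator [v]. *)
  have core_case v v' : in_edge3 v -> v != v' ->
      ~ (forall k, orientation k -> split_nf k (NGen v) = split_nf k (NGen v')).
    move=> cv /eqP vv'; have [k ok kv] := orientation_at v' false => /(_ k ok).
    by rewrite /= cv kv; case: ifP => // _ [].
  have [cu|nu] := boolP (in_edge3 u); first exact: core_case cu uu' e.
  have [cu'|nu'] := boolP (in_edge3 u').
    by apply: (core_case _ u cu') => [|k ok]; rewrite 1?eq_sym // e.
  have [k ok] := orientation_neq uu'; have := e k ok.
  by rewrite /= (negbTE nu) (negbTE nu'); case: (k u); case: (k u').
- by case: (@genN u (@NCo H w')).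
- by case: (@genN u' (@NCo H w)) => // k ok; rewrite e.
Qed.

End Splitting.

(** * Recovering a hypergraph semiring from its core *)

Lemma variety_of_core (H : hypergraph3) C : is_variety C ->
  C (hypergraph_semiring (core H)) -> C (hypergraph_semiring H).
Proof.
have H3 := hgraph3P H; have [e E c] := edge_eq3 H3.
have [_ [_ [_ [/core_edge_ex[x [y [z [_ _ _ xyz']]]] _]]]] := card3_edge3 E c.
have xyz : edge3 (val x) (val y) (val z) by rewrite -edge3_core.
(* This is [split_edge2] with values in the core: [insub] both tests membership in a 3-edge and
   lifts the vertex. The power is indexed by the orientations. *)
pose f (k : {k | @orientation H k}) (u : vertex H) : seq (vertex (core H)) :=
  if insub u is Some v then [:: v] else if sval k u then [:: x] else [:: y; z].
have fE k s : map (omap val) (subst (f k) s) =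
    subst (split_edge2 (val x) (val y) (val z) (sval k)) s.
  elim: s => //= g s IH; rewrite /subst /= map_cat -/(subst _ s) IH; congr (_ ++ _).
  case: g => //= u; rewrite /f /split_edge2.
  case: insubP => [v cu <-|/negbTE ->]; first by rewrite (valP v).
  by case: ifP.
have f0 k u : f k u != [::] by rewrite /f; case: insub => //; case: ifP.
have fP k s : s != [::] -> eval s <> NZero H ->
    nf_val (eval (subst (f k) s)) = split_nf (val x) (sval k) (eval s).
  by move=> s0 nz; rewrite -eval_core fE (eval_split xyz (svalP k) s0 nz).
apply: (variety_subst f0) => [s s0|s t s0 t0 nzs nzt].
  split=> [/(split_zero xyz s0)[k ok e0]|[k e0]].
    by exists (exist _ k ok); apply/nf_val_zero; rewrite -eval_core fE.
  case: (pselect (eval s = NZero H)) => // nz.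
  by have := fP k s s0 nz; rewrite e0 => /esym/split_nf_zero.
split=> [est k|est]; first by apply: (@nf_val_inj H); rewrite !fP // est.
apply: (split_nf_inj (x := val x)) => k ok.
by have := congr1 (@nf_val H) (est (exist _ k ok)); rewrite !fP.
Qed.

Theorem theorem2p6 (I : Type) (H : I -> hypergraph3) :
  exists (J : Type) (H' : J -> hypergraph3),
    (forall j : J, uniform3 (H' j)) /\
    (forall A : semiring,
       variety_gen (fun i : I => hypergraph_semiring (H i)) A <->
       variety_gen (fun j : J => hypergraph_semiring (H' j)) A).
Proof.
(* Each hypergraph is replaced by its core; a variety contains one semiring iff it contains the
   other, index by index. *)
exists I, (fun i => core (H i)); split=> [i|A]; first exact: core_uniform3.
split=> gA C vC CH; apply: (gA C vC) => i.
  exact: variety_of_core vC (CH i).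
exact: variety_core vC (CH i).
Qed.
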